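(* There are absolute constants $\epsilon,\gamma>0$ such that there is no $(1-\epsilon)$-approximately truthful-in-expectation mechanism for the flexible combinatorial public projects problem with submodular valuations in the value oracle model which uses a number of value queries bounded by a polynomial in $m$ and which, for all sufficiently large numbers $m$ of projects, achieves a better than $1/m^{\gamma}$-approximation in expectation to the optimal social welfare. This is true even in the case of a single player.
   Context: Flexible combinatorial public projects (CPP): there is a set $[m]=\{1,\dots,m\}$ of projects, a cardinality bound $k$ with $0\le k\le m$ (part of the input), and $n$ players. Player $i$ has a valuation $v_i:2^{[m]}\to\mathbb{R}_+$ that is normalized ($v_i(\emptyset)=0$), monotone and submodular. A feasible solution is a set $S\subseteq[m]$ with $|S|\le k$; player $i$'s value for it is $v_i(S)$; the social welfare is $\sum_i v_i(S)$. A (randomized, direct-revelation) mechanism consists of an allocation rule $\mathcal{A}$, mapping reported valuations $v=(v_1,\dots,v_n)$ to a random feasible set $\mathcal{A}(v)$, and a payment rule $p$, mapping reported valuations to random payments $p_i(v)$. Mechanisms are assumed individually rational in expectation ($\mathbf{E}[v_i(\mathcal{A}(v))-p_i(v)]\ge 0$) and to have non-negative expected payments ($\mathbf{E}[p_i(v)]\ge 0$), for all $i$ and $v$. The mechanism is $(1-\epsilon)$-approximately truthful-in-expectation if for every player $i$, every $v_i$, $v_i'$ and every $v_{-i}$, $$\mathbf{E}[v_i(\mathcal{A}(v))-p_i(v)]\ \ge\ (1-\epsilon)\,\mathbf{E}[v_i(\mathcal{A}(v_i',v_{-i}))-p_i(v_i',v_{-i})],$$ where $v=(v_i,v_{-i})$.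 Value oracle model: the mechanism can access each $v_i$ only through queries $S\subseteq[m]$ answered by $v_i(S)$. The mechanism achieves a $c$-approximation if for every input the expected social welfare of $\mathcal{A}(v)$ is at least $c$ times the maximum social welfare over feasible sets; ''better than $1/m^\gamma$'' means $c=c(m)>m^{-\gamma}$. *)

(* Defs.v *)
From HB Require Import structures.
From mathcomp Require Import all_boot all_order all_algebra.
From mathcomp Require Import all_classical all_reals all_analysis.

Set Implicit Arguments.
Unset Strict Implicit.
Unset Printing Implicit Defensive.

Import Order.TTheory GRing.Theory Num.Theory.

Local Open Scope ring_scope.

Section Valuations.
Variables (R : realType) (n m : nat).

Definition is_valuation (u : {set 'I_m} -> R) : Prop :=
  [/\ forall S, 0 <= u S,
      u finset.set0 = 0,
      forall S T : {set 'I_m}, S \subset T -> u S <= u T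
    & forall S T : {set 'I_m}, u (S :|: T) + u (S :&: T) <= u S + u T].

Definition profile := 'I_n -> {set 'I_m} -> R.

Definition valid_profile (v : profile) : Prop := forall i, is_valuation (v i).

Definition welfare (v : profile) (S : {set 'I_m}) : R := \sum_(i < n) v i S.

(* The default value 0 is harmless: welfare is nonnegative on valid profiles. *)
Definition opt_welfare (k : nat) (v : profile) : R :=
  \big[Num.max/0]_(S : {set 'I_m} | (#|S| <= k)%N) welfare v S.

(* A deterministic adaptive value-query protocol: [Query i A next] asks for
   v_i(A) and continues with [next] applied to the answer; [Output A p] stops
   with the project set A and the vector p of payments. *)
Inductive protocol : Type :=
| Output of {set 'I_m} & ('I_n -> R)
| Query of 'I_n & {set 'I_m} & (R -> protocol).

Fixpoint run (t : protocol) (v : profile) : {set 'I_m} * ('I_n -> R) :=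
  match t with
  | Output A p => (A, p)
  | Query i A next => run (next (v i A)) v
  end.

Fixpoint num_queries (t : protocol) (v : profile) : nat :=
  match t with
  | Output _ _ => 0%N
  | Query i A next => (num_queries (next (v i A)) v).+1
  end.

(* A randomized mechanism draws a seed from an arbitrary probability space and
   then runs a deterministic protocol. *)
Record mechanism := Mechanism {
  seed_display : measure_display;
  seed : measurableType seed_display;
  seed_law : probability seed R;
  strategy : seed -> protocol }.

Definition alloc (M : mechanism) (v : profile) (w : seed M) : {set 'I_m} :=
  (run (strategy w) v).1.

Definition payment (M : mechanism) (v : profile) (i : 'I_n) (w : seed M) : R :=
  (run (strategy w) v).2 i.

(* The outcome is a random feasible set together with payments having a
   (finite) expectation. *)
Definition well_defined (k : nat) (M : mechanism) : Prop :=
  forall v, valid_profile v ->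
  [/\ forall w : seed M, (#|alloc v w| <= k)%N,
      forall S, measurable [set w : seed M | alloc v w = S]%classic
    & forall i, (seed_law M).-integrable setT (EFin \o @payment M v i)].

(* Expected utility of player i with true valuation u when v is reported. *)
Definition exp_utility (M : mechanism) (i : 'I_n) (u : {set 'I_m} -> R)
    (v : profile) : \bar R :=
  'E_(seed_law M) [fun w => u (alloc v w) - payment v i w].

Definition individually_rational (M : mechanism) : Prop :=
  forall v i, valid_profile v -> (0 <= exp_utility M i (v i) v)%E.

Definition nonneg_payments (M : mechanism) : Prop :=
  forall v i, valid_profile v -> (0 <= 'E_(seed_law M) [@payment M v i])%E.

Definition approx_truthful (eps : R) (M : mechanism) : Prop :=
  forall v i (u : {set 'I_m} -> R), valid_profile v -> is_valuation u ->
  (exp_utility M i (v i) v >=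
   (1 - eps)%:E * exp_utility M i (v i) [eta v with i |-> u])%E.

Definition approximates (k : nat) (c : R) (M : mechanism) : Prop :=
  forall v, valid_profile v ->
  ((c * opt_welfare k v)%:E <=
   'E_(seed_law M) [fun w => welfare v (alloc v w)])%E.

Definition query_bound (b : R) (M : mechanism) : Prop :=
  forall v (w : seed M), valid_profile v ->
  (num_queries (strategy w) v)%:R <= b.

End Valuations.

(* Main.v *)
Require Import Defs.
From HB Require Import structures.
From mathcomp Require Import all_boot all_order all_algebra.
From mathcomp Require Import all_classical all_reals all_analysis.
From mathcomp Require Import zify ring lra.

(** For a set [B] of projects let [psi_B(S) = f |S n B|], where [f] behaves like the
    square root at all scales between [4^lo] and [k].  If [A] is a random half of [B],
    there is a submodular [w >= psi_A] which coincides with [psi_B] on every set that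
    [A] splits evenly, yet satisfies [w >= (1 + 1/768) psi_A] up to a small additive
    error.  Few value queries cannot tell [t w] from [t psi_B], so on [t w] the
    mechanism earns about the value [V_B(t)] it earns on [t psi_B].  The player of type
    [t w] may however report [d t psi_A] with a small constant [d]; individual
    rationality bounds the payment then charged by [d t V_A(d t)], so approximate
    truthfulness yields [V_B(t) >= (1 + 1/3072) V_A(d t)] up to small errors.  Iterating
    from the set of all [m] projects down to about [k = m^(4/5)] projects takes
    [Omega(log m)] halvings, and the attained fraction of the optimum drops by a factor
    polynomial in [m].  Comparing values rather than utilities along the chain is what
    allows payments of arbitrary sign that are controlled only in expectation. *)

Set Implicit Arguments.
Unset Strict Implicit.
Unset Printing Implicit Defensive.

Import Order.TTheory GRing.Theory Num.Theory.

Local Open Scope ring_scope.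

(** * Submodular functions of two counts *)

(* A lattice version of [(2 * s)^2 * (1 - x / s) * (1 - y / s)]: in the band
   [x <= y + 2 * h] it depends on [x + y] only, and the shifts by [h] outside the band
   keep the slopes continuous.  Truncated subtraction performs the saturation at
   [x >= s + h]. *)
Section Uncovered.
Local Open Scope nat_scope.
Variables h s : nat.

Definition uncov (x y : nat) : nat :=
  if y + 2 * h <= x then 4 * ((s + h - x) * (s - (h + y)))
  else (2 * s - (x + y)) ^ 2.

Definition uncov_dx (x y : nat) : nat :=
  if y + 2 * h <= x then (if x < s + h then 4 * (s - (h + y)) else 0)
  else 2 * (2 * s - (x + y)) - 1.

(** The test is strict here but weak in [uncov_dx]: from the border [x = y + 2 * h], a step in [y]
    stays in the band, whereas a step in [x] leaves it. *)
Definition uncov_dy (x y : nat) : nat :=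
  if y + 2 * h < x then 4 * (s + h - x) else 2 * (2 * s - (x + y)) - 1.

Lemma uncov_balanced x y : x <= y + 2 * h -> uncov x y = (2 * s - (x + y)) ^ 2.
Proof.
rewrite /uncov => xy; case: ifP => // yx.
have -> : x = y + 2 * h by lia.
have -> : s + h - (y + 2 * h) = s - (h + y) by lia.
have -> : 2 * s - (y + 2 * h + y) = 2 * (s - (h + y)) by lia.
by rewrite expnMn -mulnn.
Qed.

Lemma uncov_skew x y : y + 2 * h <= x ->
  uncov x y = 4 * ((s + h - x) * (s - (h + y))).
Proof. by rewrite /uncov => ->. Qed.

Lemma sqrn_predE c : c ^ 2 = c.-1 ^ 2 + (2 * c - 1).
Proof. by case: c => // c; rewrite /= -addn1 sqrnD; lia. Qed.

Lemma mul4S p q : 4 * (p.+1 * q) = 4 * (p * q) + 4 * q.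
Proof. by lia. Qed.

Lemma uncov_dxE x y : uncov x y = uncov x.+1 y + uncov_dx x y.
Proof.
rewrite /uncov_dx; case: (leqP (y + 2 * h) x) => xy.
  rewrite !uncov_skew; try lia.
  case: (ltnP x (s + h)) => xs; last first.
    have E0 : s + h - x = 0 by lia.
    have E1 : s + h - x.+1 = 0 by lia.
    by rewrite E0 E1 !mul0n muln0.
  have -> : s + h - x = (s + h - x.+1).+1 by lia.
  exact: mul4S.
rewrite !uncov_balanced; try lia.
have -> : 2 * s - (x.+1 + y) = (2 * s - (x + y)).-1 by lia.
exact: sqrn_predE.
Qed.

Lemma uncov_dyE x y : uncov x y = uncov x y.+1 + uncov_dy x y.
Proof.
rewrite /uncov_dy; case: (ltnP (y + 2 * h) x) => xy.
  rewrite !uncov_skew; try lia.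
rewrite !uncov_balanced; try lia.
have -> : 2 * s - (x + y.+1) = (2 * s - (x + y)).-1 by lia.
exact: sqrn_predE.
Qed.

Lemma uncov_dx_decx x y : uncov_dx x.+1 y <= uncov_dx x y.
Proof. by rewrite /uncov_dx; do !case: ifP; lia. Qed.

Lemma uncov_dy_decx x y : uncov_dy x.+1 y <= uncov_dy x y.
Proof. by rewrite /uncov_dy; do !case: ifP; lia. Qed.

Lemma uncov_dy_decy x y : uncov_dy x y.+1 <= uncov_dy x y.
Proof. by rewrite /uncov_dy; do !case: ifP; lia. Qed.

Lemma uncov_le_sqr x : uncov x 0 <= (2 * s - x) ^ 2.
Proof.
rewrite /uncov; case: ifP => [xh|_]; last by rewrite addn0.
have [E|xs] := posnP (s + h - x); first by rewrite ?E ?mul0n ?muln0.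
rewrite addn0; set p := s + h - x in xs *.
have [->|hs] := posnP (s - h); first by rewrite muln0.
have -> : 2 * s - x = p + (s - h) by lia.
by have [] := nat_AGM2 p (s - h).
Qed.

(** With [p = s + h - x] and [r = s - h], this is [4 p r + (r - p)^2 = (p + r)^2]: the gain of a
    skew set is the defect in the AM-GM inequality. *)
Lemma uncov_gain x : 2 * h <= x -> x <= s ->
  uncov x 0 + (x - 2 * h) ^ 2 = (2 * s - x) ^ 2.
Proof.
move=> hx xs; rewrite uncov_skew ?add0n //.
rewrite addn0; set p := s + h - x.
have -> : 2 * s - x = p + (s - h) by lia.
have -> : x - 2 * h = (s - h) - p by lia.
have le : p <= s - h by lia.
by rewrite -(sqrnD_sub le) (addnC (s - h) p) (mulnC (s - h) p) subnKC //; have [] := nat_AGM2 p (s - h).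
Qed.

End Uncovered.

(** * Submodularity from second differences *)

Section Submodular2.
Variable R : realType.

Record submodular2 (g : nat -> nat -> R) : Prop := Submodular2 {
  sub2_00 : g 0 0 = 0;
  sub2_x : forall x y, g x y <= g x.+1 y;
  sub2_y : forall x y, g x y <= g x y.+1;
  sub2_xx : forall x y, g x.+2 y - g x.+1 y <= g x.+1 y - g x y;
  sub2_xy : forall x y, g x.+1 y.+1 - g x.+1 y <= g x y.+1 - g x y;
  sub2_yy : forall x y, g x y.+2 - g x y.+1 <= g x y.+1 - g x y }.

Variable g : nat -> nat -> R.
Hypothesis sg : submodular2 g.

Lemma sub2_mono a c x y : g x y <= g (x + a)%N (y + c)%N.
Proof.
elim: a => [|a IH]; last by apply: (le_trans IH); rewrite addnS; exact: (sub2_x sg).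
rewrite addn0; elim: c => [|c IH]; first by rewrite addn0.
by apply: (le_trans IH); rewrite addnS; exact: (sub2_y sg).
Qed.

Lemma sub2_ge0 x y : 0 <= g x y.
Proof. by rewrite -(sub2_00 sg) -[x]add0n -[y]add0n sub2_mono. Qed.

Lemma sub2_dx x y b d : g (x + b).+1 (y + d)%N - g (x + b)%N (y + d)%N <= g x.+1 y - g x y.
Proof.
elim: b => [|b IH]; last first.
  apply: le_trans IH; rewrite addnS; exact: (sub2_xx sg).
elim: d => [|d IH]; first by rewrite !addn0.
apply: le_trans IH; rewrite addnS.
have := sub2_xy sg (x + 0) (y + d); lra.
Qed.

Lemma sub2_dy x y b d : g (x + b)%N (y + d).+1 - g (x + b)%N (y + d)%N <= g x y.+1 - g x y.
Proof.
elim: b => [|b IH]; last first.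
  apply: le_trans IH; rewrite addnS; exact: (sub2_xy sg).
elim: d => [|d IH]; first by rewrite !addn0.
apply: le_trans IH; rewrite addnS; exact: (sub2_yy sg).
Qed.

(** Telescope along [a] steps in [x] ([Hx]) and [c] steps in [y] ([Hy]); moving the base point of a
    step upwards never increases its increment. *)
Lemma sub2_lattice x y a b c d :
  g (x + a + b)%N (y + c + d)%N + g x y <= g (x + a)%N (y + c)%N + g (x + b)%N (y + d)%N.
Proof.
have Hx : g (x + a + b)%N (y + c + d)%N - g (x + b)%N (y + c + d)%N
          <= g (x + a)%N (y + c)%N - g x (y + c)%N.
  elim: a => [|a IH]; first by rewrite addn0 !subrr.
  have := sub2_dx (x + a) (y + c) b d.
  rewrite addnS addSn; lra.
have Hy : g (x + b)%N (y + c + d)%N - g (x + b)%N (y + d)%N <= g x (y + c)%N - g x y.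
  elim: c {Hx} => [|c IH]; first by rewrite addn0 !subrr.
  have := sub2_dy x (y + c) b d.
  rewrite addnS addSn; lra.
lra.
Qed.

Lemma sub2_valuation m (A B : {set 'I_m}) :
  is_valuation (fun S : {set 'I_m} => g #|S :&: A| #|S :&: B|).
Proof.
split=> [S||S T ST|S T].
- exact: sub2_ge0.
- by rewrite !finset.set0I cards0 (sub2_00 sg).
- have SA : (#|S :&: A| <= #|T :&: A|)%N by apply/subset_leq_card/finset.setSI.
  have SB : (#|S :&: B| <= #|T :&: B|)%N by apply/subset_leq_card/finset.setSI.
  by rewrite -(subnKC SA) -(subnKC SB) sub2_mono.
- have E (C : {set 'I_m}) : (#|(S :|: T) :&: C| + #|S :&: T :&: C|
      = #|S :&: C| + #|T :&: C|)%N.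
    by rewrite finset.setIUl finset.setIIl cardsUI.
  have L (C : {set 'I_m}) : (#|S :&: T :&: C| <= #|S :&: C|)%N.
    by apply/subset_leq_card/finset.setSI/finset.subsetIl.
  have L' (C : {set 'I_m}) : (#|S :&: T :&: C| <= #|T :&: C|)%N.
    by apply/subset_leq_card/finset.setSI/finset.subsetIr.
  have EA := E A; have EB := E B; have LA := L A; have LB := L B.
  have LA' := L' A; have LB' := L' B.
  set x0 := #|S :&: T :&: A| in EA LA LA' *; set y0 := #|S :&: T :&: B| in EB LB LB' *.
  (* The counts of [S :&: T] are the lower corner, and inclusion-exclusion puts those of [S :|: T]
     at the upper corner. *)
  have := sub2_lattice x0 y0 (#|S :&: A| - x0) (#|T :&: A| - x0)
                       (#|S :&: B| - y0) (#|T :&: B| - y0).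
  rewrite (_ : (x0 + _ + _)%N = #|(S :|: T) :&: A|); last lia.
  rewrite (_ : (y0 + _ + _)%N = #|(S :|: T) :&: B|); last lia.
  rewrite !subnKC //; lia.
Qed.

End Submodular2.

Lemma valuation_scale (R : realType) m (t : R) (u : {set 'I_m} -> R) :
  0 <= t -> is_valuation u -> is_valuation (fun S => t * u S).
Proof.
move=> t0 [u0 us um usub]; split=> [S||S T ST|S T].
- exact: mulr_ge0.
- by rewrite us mulr0.
- exact/ler_wpM2l/um.
- by rewrite -!mulrDr ler_wpM2l.
Qed.

(** * The hidden function *)

Section HiddenFunction.
Variable R : realType.
Implicit Types h s x y i : nat.

Definition cov h s x y : R := 1 - (uncov h s x y)%:R / ((2 * s) ^ 2)%:R.

Lemma cov_submodular2 h s : (0 < s)%N -> submodular2 (cov h s).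
Proof.
move=> s0; have s20 : 0 < ((2 * s) ^ 2)%:R :> R by rewrite ltr0n expn_gt0 muln_gt0 s0.
have dx x y : cov h s x.+1 y - cov h s x y = (uncov_dx h s x y)%:R / ((2 * s) ^ 2)%:R.
  by rewrite /cov (uncov_dxE h s x y) natrD; ring.
have dy x y : cov h s x y.+1 - cov h s x y = (uncov_dy h s x y)%:R / ((2 * s) ^ 2)%:R.
  by rewrite /cov (uncov_dyE h s x y) natrD; ring.
split=> [|x y|x y|x y|x y|x y].
- by rewrite /cov uncov_balanced // !addn0 subn0 divff ?subrr ?gt_eqF.
- by rewrite -subr_ge0 dx divr_ge0 // ler0n.
- by rewrite -subr_ge0 dy divr_ge0 // ler0n.
- by rewrite !dx ler_wpM2r ?invr_ge0 ?ler0n // ler_nat uncov_dx_decx.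
- by rewrite !dy ler_wpM2r ?invr_ge0 ?ler0n // ler_nat uncov_dy_decx.
- by rewrite !dy ler_wpM2r ?invr_ge0 ?ler0n // ler_nat uncov_dy_decy.
Qed.

(* Superposing the scales [4^i] with weights [2^i] makes the relative gain of
   unbalanced over balanced sets the same at every scale. *)
Definition multicov h i0 i1 x y : R :=
  \sum_(i0 <= i < i1) 2 ^+ i * cov h (4 ^ i) x y.

Lemma multicov_submodular2 h i0 i1 : submodular2 (multicov h i0 i1).
Proof.
have C i := cov_submodular2 h (expn_gt0 4 i : (0 < 4 ^ i)%N).
have p2 i : 0 <= 2 ^+ i :> R by apply: exprn_ge0.
split=> [|x y|x y|x y|x y|x y].
- by rewrite /multicov big1 // => i _; rewrite (sub2_00 (C i)) mulr0.
- by apply: ler_sum => i _; rewrite ler_wpM2l // (sub2_x (C i)).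
- by apply: ler_sum => i _; rewrite ler_wpM2l // (sub2_y (C i)).
- by rewrite /multicov -!sumrB; apply: ler_sum => i _;
    rewrite -!mulrBr ler_wpM2l // (sub2_xx (C i)).
- by rewrite /multicov -!sumrB; apply: ler_sum => i _;
    rewrite -!mulrBr ler_wpM2l // (sub2_xy (C i)).
- by rewrite /multicov -!sumrB; apply: ler_sum => i _;
    rewrite -!mulrBr ler_wpM2l // (sub2_yy (C i)).
Qed.

Lemma multicov_balanced h i0 i1 x y : (x <= y + 2 * h)%N ->
  multicov h i0 i1 x y = multicov h i0 i1 0 (x + y).
Proof.
by move=> xy; apply: eq_bigr => i _; rewrite /cov !uncov_balanced // add0n.
Qed.

Lemma geo_sum2 i0 i1 : \sum_(i0 <= i < i1) 2 ^+ i <= 2 ^+ i1 :> R.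
Proof.
elim: i1 => [|i1 IH]; first by rewrite big_geq // expr0.
have [le|lt] := leqP i0 i1; last by rewrite big_geq // exprn_ge0.
by rewrite big_nat_recr //= exprS mulr_natl mulr2n lerD2r.
Qed.

Lemma geo_sum2V i0 i1 : \sum_(i0 <= i < i1) (2 ^+ i)^-1 <= 2 / 2 ^+ i0 :> R.
Proof.
have H n : \sum_(i0 <= i < i0 + n) (2 ^+ i)^-1 + (2 ^+ (i0 + n))^-1 * 2 = 2 / 2 ^+ i0 :> R.
  elim: n => [|n IH]; first by rewrite addn0 big_geq // add0r mulrC.
  rewrite addnS big_nat_recr ?leq_addr //= -IH exprS -addrA; congr (_ + _).
  by field; rewrite expf_neq0.
have [le|lt] := leqP i0 i1; last by rewrite big_geq ?(ltnW lt) // divr_ge0 ?exprn_ge0.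
by rewrite -(H (i1 - i0)%N) subnKC // lerDl mulr_ge0 // invr_ge0 exprn_ge0.
Qed.

Lemma cov_le1 h s x y : cov h s x y <= 1.
Proof. by rewrite /cov gerBl divr_ge0 ?ler0n. Qed.

Lemma multicov_le h i0 i1 x y : multicov h i0 i1 x y <= 2 ^+ i1.
Proof.
apply: le_trans (geo_sum2 i0 i1); apply: ler_sum => i _.
by rewrite ler_piMr ?exprn_ge0 // cov_le1.
Qed.

Lemma cov_lin h s x : (0 < s)%N -> cov h s 0 x <= x%:R / s%:R.
Proof.
move=> s0; rewrite /cov uncov_balanced // add0n.
have s0r : 0 < s%:R :> R by rewrite ltr0n.
have [xs|xs] := leqP x (2 * s).
  rewrite !natrX natrB // natrM.
  rewrite -subr_ge0.
  have -> : x%:R / s%:R - (1 - (2 * s%:R - x%:R) ^+ 2 / (2 * s%:R) ^+ 2)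
    = (x%:R / (2 * s%:R)) ^+ 2 :> R.
    by field; rewrite gt_eqF.
  exact: sqr_ge0.
have : 1 <= x%:R / s%:R :> R.
  by rewrite ler_pdivlMr // mul1r ler_nat; lia.
apply: le_trans; rewrite gerBl divr_ge0 ?ler0n //.
Qed.

(** Scale [4^i] contributes at most [2^i * x / 4^i = x / 2^i], a geometric series. *)
Lemma multicov_lin h i0 i1 x : multicov h i0 i1 0 x <= 2 * x%:R / 2 ^+ i0.
Proof.
apply: (@le_trans _ _ (x%:R * \sum_(i0 <= i < i1) (2 ^+ i)^-1)); last first.
  rewrite [leRHS](_ : _ = x%:R * (2 / 2 ^+ i0)); last by ring.
  by rewrite ler_wpM2l ?ler0n // geo_sum2V.
rewrite mulr_sumr; apply: ler_sum => i _.
apply: (@le_trans _ _ (2 ^+ i * (x%:R / (4 ^ i)%:R))).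
  by rewrite ler_wpM2l ?exprn_ge0 // cov_lin // expn_gt0.
rewrite natrX (_ : 4%:R = 2 * 2 :> R) ?exprMn; last by lra.
by rewrite le_eqVlt; apply/orP; left; apply/eqP; field; rewrite expf_neq0.
Qed.

(** The scales below [i] are bounded by saturation, giving [2^i], and the others by the linear
    bound, giving [2 * 2^i]. *)
Lemma multicov_upper h i0 i i1 x : (i0 <= i <= i1)%N -> (x <= 4 ^ i)%N ->
  multicov h i0 i1 0 x <= 3 * 2 ^+ i.
Proof.
move=> /andP[i0i ii1] xi.
rewrite /multicov (big_cat_nat i0i ii1) /=.
have := multicov_le h i0 i 0 x; have := multicov_lin h i i1 x.
rewrite /multicov.
have : 2 * x%:R / 2 ^+ i <= 2 * 2 ^+ i :> R.
  rewrite ler_pdivrMr ?exprn_gt0 // -mulrA -exprMn (_ : 2 * 2 = 4%:R :> R); last lra.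
  by rewrite ler_wpM2l // -natrX ler_nat.
lra.
Qed.

Lemma cov_skew_ge h s x : cov h s 0 x <= cov h s x 0.
Proof.
rewrite /cov lerD2l lerN2 ler_wpM2r ?invr_ge0 ?ler0n // ler_nat.
by rewrite (@uncov_balanced h s 0 x) // add0n uncov_le_sqr.
Qed.

(** Here [x - 2h >= x/2 >= s/8], so the gain [(x - 2h)^2 / (2s)^2] is at least [1/16^2]. *)
Lemma cov_gain h s x : (4 * h <= x)%N -> (x <= s)%N -> (s <= 4 * x)%N -> (0 < s)%N ->
  cov h s 0 x + 1 / 256 <= cov h s x 0.
Proof.
move=> hx xs sx s0; rewrite /cov (@uncov_balanced h s 0 x) // add0n.
rewrite -(@uncov_gain h s x) //; try lia.
rewrite natrD mulrDl opprD.
have : 1 / 256 <= ((x - 2 * h) ^ 2)%:R / ((2 * s) ^ 2)%:R :> R; last by lra.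
rewrite ler_pdivlMr ?ltr0n ?expn_gt0 ?muln_gt0 ?s0 //.
rewrite mulrC mulrA mulr1 ler_pdivrMr ?ltr0n //.
rewrite (_ : 256 = (16 ^ 2)%:R :> R) ?natrX -?natrX; last by rewrite natrX; lra.
rewrite -natrM ler_nat -expnMn leq_exp2r //; lia.
Qed.

(** If [x > 4^i0], the least scale [4^i >= x] alone gains [2^i / 256], while the whole sum is at
    most [3 * 2^i]; hence [1/768]. If [x <= 4^i0], the sum is at most [2 * 2^i0], and [1/768] of
    that is the additive error. *)
Lemma multicov_gain h i0 i1 x : (4 * h <= 4 ^ i0)%N -> (x <= 4 ^ i1)%N -> (i0 <= i1)%N ->
  (1 + 1 / 768) * multicov h i0 i1.+1 0 x <= multicov h i0 i1.+1 x 0 + 2 ^+ i0 / 384.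
Proof.
move=> hi xi1 i01.
have base : multicov h i0 i1.+1 0 x <= multicov h i0 i1.+1 x 0.
  by apply: ler_sum => i _; rewrite ler_wpM2l ?exprn_ge0 // cov_skew_ge.
have [xi0|xi0] := leqP x (4 ^ i0).
  have : multicov h i0 i1.+1 0 x <= 2 * 2 ^+ i0.
    apply: le_trans (multicov_lin _ _ _ _) _.
    rewrite ler_pdivrMr ?exprn_gt0 // -mulrA -exprMn (_ : 2 * 2 = 4%:R :> R); last lra.
    by rewrite ler_wpM2l // -natrX ler_nat.
  by move: base; lra.
have ex : exists i, (x <= 4 ^ i)%N by exists i1.
have [i xi min] := ex_minnP ex.
have ii1 : (i <= i1)%N by apply: min.
have i0i : (i0 < i)%N.
  by rewrite ltnNge; apply/negP => le; have := leq_pexp2l (isT : 0 < 4)%N le; lia.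
have xi' : (4 ^ i <= 4 * x)%N.
  case: i i0i {ii1} xi min => // i i0i _ min; rewrite expnS leq_mul2l /=.
  by rewrite leqNgt; apply/negP => /ltnW /min; rewrite ltnn.
have U : multicov h i0 i1.+1 0 x <= 3 * 2 ^+ i by apply: multicov_upper => //; lia.
have G : multicov h i0 i1.+1 0 x + 2 ^+ i / 256 <= multicov h i0 i1.+1 x 0.
  rewrite /multicov.
  have split f : \sum_(i0 <= j < i1.+1) f j
      = \sum_(i0 <= j < i) f j + (f i + \sum_(i.+1 <= j < i1.+1) f j) :> R.
    by rewrite (@big_cat_nat _ _ _ i) ?(ltnW i0i) ?(leqW ii1) //= [in LHS](@big_ltn _ _ _ i).
  rewrite !split.
  have A j k : \sum_(j <= i < k) 2 ^+ i * cov h (4 ^ i) 0 x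
      <= \sum_(j <= i < k) 2 ^+ i * cov h (4 ^ i) x 0.
    by apply: ler_sum => l _; rewrite ler_wpM2l ?exprn_ge0 // cov_skew_ge.
  have A1 := A i0 i; have A2 := A i.+1 i1.+1.
  have : 2 ^+ i * (cov h (4 ^ i) 0 x + 1 / 256) <= 2 ^+ i * cov h (4 ^ i) x 0.
    rewrite ler_wpM2l ?exprn_ge0 // cov_gain ?expn_gt0 //; lia.
  by rewrite mulrDr; lra.
have : 0 <= 2 ^+ i0 :> R by apply: exprn_ge0.
lra.
Qed.

(** The top scale alone suffices: at [x >= s] at most a quarter of [(2s)^2] is left uncovered. *)
Lemma multicov_lower h i0 i1 x : (i0 <= i1)%N -> (4 ^ i1 <= x)%N ->
  3 / 4 * 2 ^+ i1 <= multicov h i0 i1.+1 0 x.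
Proof.
move=> i01 xi; rewrite /multicov big_nat_recr //=.
have s0 : (0 < 4 ^ i1)%N by rewrite expn_gt0.
have : 0 <= \sum_(i0 <= i < i1) 2 ^+ i * cov h (4 ^ i) 0 x.
  apply: sumr_ge0 => i _; rewrite mulr_ge0 ?exprn_ge0 //.
  by rewrite (sub2_ge0 (cov_submodular2 _ _)) // expn_gt0.
have : 3 / 4 <= cov h (4 ^ i1) 0 x.
  rewrite /cov uncov_balanced // add0n.
  have : (2 * 4 ^ i1 - x <= 4 ^ i1)%N by lia.
  set s := (4 ^ i1)%N in s0 *; rewrite -(leq_exp2r _ _ (isT : 0 < 2)%N) -(@ler_nat R) => H.
  have : ((2 * s - x) ^ 2)%:R / ((2 * s) ^ 2)%:R <= 1 / 4 :> R; last by lra.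
  rewrite ler_pdivrMr ?ltr0n ?expn_gt0 ?muln_gt0 ?s0 //.
  by apply: le_trans H _; rewrite expnMn natrM; lra.
move=> H1; have : 2 ^+ i1 * (3 / 4) <= 2 ^+ i1 * cov h (4 ^ i1) 0 x.
  by rewrite ler_wpM2l ?exprn_ge0.
lra.
Qed.

End HiddenFunction.

(** * Random splits *)

Lemma bernoulli_expr (R : realType) (x : R) n : -1 <= x -> 1 + n%:R * x <= (1 + x) ^+ n.
Proof.
move=> x1; elim: n => [|n IH]; first by rewrite mul0r addr0 expr0.
have x10 : 0 <= 1 + x by lra.
rewrite exprS; apply: le_trans (ler_wpM2l x10 IH).
have : 0 <= n%:R * x ^+ 2 by rewrite mulr_ge0 ?ler0n ?sqr_ge0.
by rewrite -natr1 expr2; nra.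
Qed.

Section Imbalance.
Variables (R : realType) (m : nat).
Implicit Types Z J : {set 'I_m}.

Definition imbalanced tau Z J := (#|Z :\: J| + tau < #|Z :&: J|)%N.

(* A Chernoff bound: a uniformly random [J] gives each element of [Z] the expected
   weight [1]. *)
Lemma sum_subset_weight (t : R) Z :
  \sum_(J : {set 'I_m}) (1 + t) ^+ #|Z :&: J| * (1 - t) ^+ #|Z :\: J| = 2 ^+ m.
Proof.
pose F i := if i \in Z then 1 + t else 1; pose G i := if i \in Z then 1 - t else 1.
transitivity (\prod_(i < m) (F i + G i)).
  rewrite bigA_distr; apply: eq_bigr => J _.
  rewrite (eq_bigr (fun i => (if i \in Z :&: J then 1 + t else 1)
                           * (if i \in Z :\: J then 1 - t else 1))).
    by rewrite big_split /= -!big_mkcond /= !prodr_const.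
  move=> i _; rewrite /F /G !inE; case: (i \in J) => /=.
    by rewrite andbT mulr1.
  by rewrite andbF mul1r.
rewrite (eq_bigr (fun=> 2)); last by move=> i _; rewrite /F /G; case: ifP => _; lra.
by rewrite prodr_const card_ord.
Qed.

(** Markov's inequality: on an imbalanced [J], pairing each factor [1 - t] with a factor [1 + t]
    leaves at least [tau] unpaired factors [1 + t]. *)
Lemma card_imbalanced_weight (t : R) tau Z : 0 <= t <= 1 ->
  #|[set J | imbalanced tau Z J]|%:R * ((1 - t ^+ 2) ^+ m * (1 + t) ^+ tau) <= 2 ^+ m.
Proof.
move=> /andP[t0 t1].
rewrite -(sum_subset_weight t Z) mulr_natl -sumr_const.
rewrite [leRHS](bigID (mem [set J | imbalanced tau Z J])) /= -[leLHS]addr0.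
have wge0 J : 0 <= (1 + t) ^+ #|Z :&: J| * (1 - t) ^+ #|Z :\: J|.
  by rewrite mulr_ge0 ?exprn_ge0 //; lra.
apply: lerD; last by apply: sumr_ge0 => J _.
apply: ler_sum => J; rewrite inE => /ltnW ub.
have Zm : (#|Z :\: J| <= m)%N by rewrite -[X in (_ <= X)%N]card_ord max_card.
have t2 : 0 <= 1 - t ^+ 2 <= 1 by rewrite expr2; apply/andP; split; nra.
apply: (@le_trans _ _ ((1 - t ^+ 2) ^+ #|Z :\: J| * (1 + t) ^+ tau)).
  rewrite ler_wpM2r ?exprn_ge0 //; first by lra.
  by apply: ler_wiXn2l => //; case/andP: t2.
have -> : 1 - t ^+ 2 = (1 + t) * (1 - t) by rewrite expr2; ring.
rewrite exprMn mulrAC ler_wpM2r ?exprn_ge0 //; first by lra.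
by rewrite -exprD ler_weXn2l //; lra.
Qed.

Lemma card_imbalanced q p Z : (0 < q)%N -> m = (4 * q ^ 2)%N ->
  #|[set J | imbalanced (2 * q * p) Z J]|%:R <= 4 / 2 ^+ p * 2 ^+ m :> R.
Proof.
move=> q0 mq.
have q0r : 0 < q%:R :> R by rewrite ltr0n.
have q1r : 1 <= q%:R :> R by rewrite ler1n.
(* This is [m^(-1/2)], so that [(1 - t^2)^m] stays above a constant while [2q] factors [1 + t]
   already give [2]. *)
pose t : R := (2 * q%:R)^-1.
have t0 : 0 <= t by rewrite invr_ge0; lra.
have t1 : t <= 1 by rewrite invf_le1; lra.
have := @card_imbalanced_weight t (2 * q * p) Z.
rewrite t0 t1 => /(_ isT).
set c := #|_|%:R => H.
have A : 1 / 4 <= (1 - t ^+ 2) ^+ m.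
  (* Bernoulli's inequality on all [m] factors would only give [0]; on half of them it gives [1/2],
     which is then squared. *)
  have -> : m = (2 * q ^ 2 * 2)%N by lia.
  rewrite exprM.
  have B : 1 / 2 <= (1 - t ^+ 2) ^+ (2 * q ^ 2).
    have := @bernoulli_expr R (- t ^+ 2) (2 * q ^ 2).
    have -> : 1 + (2 * q ^ 2)%:R * - t ^+ 2 = 1 / 2.
      by rewrite natrM natrX /t; field; rewrite gt_eqF.
    by apply; rewrite lerN2 expr_le1.
  rewrite -[1 / 4](_ : (1 / 2) ^+ 2 = _); last by rewrite expr2; lra.
  by rewrite lerXn2r ?nnegrE //; lra.
have B : 2 ^+ p <= (1 + t) ^+ (2 * q * p).
  rewrite exprM lerXn2r ?nnegrE ?exprn_ge0 //; first by lra.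
  have := @bernoulli_expr R t (2 * q).
  have -> : 1 + (2 * q)%:R * t = 2 by rewrite natrM /t; field; rewrite gt_eqF.
  by apply; lra.
have c0 : 0 <= c by rewrite ler0n.
have p0 : 0 < 2 ^+ p :> R by rewrite exprn_gt0.
have : c * (1 / 4 * 2 ^+ p) <= 2 ^+ m.
  apply: le_trans H; rewrite ler_wpM2l // ler_pM //; lra.
have -> : 4 / 2 ^+ p * 2 ^+ m = 4 * 2 ^+ m / 2 ^+ p :> R by ring.
by rewrite ler_pdivlMr //; lra.
Qed.

End Imbalance.

(** * Mechanisms facing a single active player *)

Section Protocols.
Variables (R : realType) (n m : nat).
Implicit Types (t : protocol R n m) (v : profile R n m).

Fixpoint queries t v : seq {set 'I_m} :=
  match t with
  | Output _ _ => [::]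
  | Query i A next => A :: queries (next (v i A)) v
  end.

Lemma size_queries t v : size (queries t v) = num_queries t v.
Proof. by elim: t => //= i A next IH; rewrite IH. Qed.

Lemma run_agree t v v' :
  (forall A, A \in queries t v -> forall i, v' i A = v i A) -> run t v' = run t v.
Proof.
elim: t => //= i A next IH agree.
rewrite agree ?mem_head //; apply: IH => C Cq j.
by apply: agree; rewrite inE Cq orbT.
Qed.

End Protocols.

Lemma Rintegral_sum d (T : measurableType d) (R : realType)
    (mu : {measure set T -> \bar R}) (I : Type) (s : seq I) (Q : pred I) (f : I -> T -> R) :
  (forall i, mu.-integrable setT (EFin \o f i)) ->
  mu.-integrable setT (EFin \o (fun w => \sum_(i <- s | Q i) f i w)) /\
  (\int[mu]_w (\sum_(i <- s | Q i) f i w) = \sum_(i <- s | Q i) \int[mu]_w f i w)%R.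
Proof.
move=> fi; elim: s => [|i s [IHi IH]].
  split.
    rewrite (_ : _ \o _ = cst 0%:E); first exact: integrable0.
    by apply/funext => w /=; rewrite big_nil.
  rewrite big_nil; under eq_Rintegral do rewrite big_nil.
  by rewrite /Rintegral integral0.
case Qi: (Q i); last first.
  split; last by rewrite big_cons Qi -IH; under eq_Rintegral do rewrite big_cons Qi.
  by rewrite (_ : _ \o _ = EFin \o (fun w => \sum_(i <- s | Q i) f i w)) //;
    apply/funext => w /=; rewrite big_cons Qi.
split.
  rewrite (_ : _ \o _ = (EFin \o f i) \+ (EFin \o (fun w => \sum_(i <- s | Q i) f i w))).
    exact: integrableD.
  by apply/funext => w /=; rewrite big_cons Qi EFinD.
rewrite big_cons Qi -IH -RintegralD //.
by apply: eq_Rintegral => w _; rewrite big_cons Qi.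
Qed.

Section SinglePlayer.
Variables (R : realType) (n m k : nat) (M : mechanism R n m) (i0 : 'I_n) (eps : R).
Hypothesis M_wd : well_defined k M.
Hypothesis M_ir : individually_rational M.
Hypothesis M_np : nonneg_payments M.
Hypothesis M_at : approx_truthful eps M.
Implicit Types u psi : {set 'I_m} -> R.

(** Silencing the other players makes the welfare equal to the value of [i0], so the one-player
    argument applies for every [n > 0]. *)
Definition solo u : profile R n m := [eta (fun _ _ => 0) with i0 |-> u].

Lemma solo_valid u : is_valuation u -> valid_profile (solo u).
Proof.
move=> uv i; rewrite /solo /=; case: eqP => // _.
Qed.

Lemma solo_update u u' : [eta solo u with i0 |-> u'] = solo u' :> profile R n m.
Proof. by apply/funext => i; rewrite /solo /=; case: eqP. Qed.

Lemma welfare_solo u S : welfare (solo u) S = u S.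
Proof.
rewrite /welfare (bigD1 i0) //= /solo /= eqxx big1 ?addr0 // => i /negbTE ni.
by rewrite ni.
Qed.

Definition expval (u g : {set 'I_m} -> R) : R :=
  (\int[seed_law M]_w g (alloc (solo u) w))%R.

Definition exppay u : R := (\int[seed_law M]_w payment (solo u) i0 w)%R.

(** The integrand is a finite linear combination of indicators of the measurable events that [alloc]
    equals [S]. *)
Lemma alloc_integrable u (g : {set 'I_m} -> R) : is_valuation u ->
  (seed_law M).-integrable setT (EFin \o (fun w => g (alloc (solo u) w))).
Proof.
move=> uv; have [_ mS _] := M_wd (solo_valid uv).
have := @Rintegral_sum _ _ _ (seed_law M) {set 'I_m} (index_enum _) predT
  (fun S w => g S * \1_[set w | alloc (solo u) w = S]%classic w).
case=> [S|+ _].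
  rewrite (_ : _ \o _ = (fun w => (g S)%:E * (EFin \o \1_[set w | alloc (solo u) w = S]%classic) w)%E) //.
  by apply: integrableZl => //; apply: integrable_indic.
rewrite (_ : _ \o _ = EFin \o (fun w => g (alloc (solo u) w))) //.
apply/funext => w /=; congr EFin.
rewrite (bigD1 (alloc (solo u) w)) //= indicE mem_set // mulr1 big1 ?addr0 // => S nS.
by rewrite indicE memNset ?mulr0 // => E; rewrite E eqxx in nS.
Qed.

Lemma expvalZ u c g : is_valuation u -> expval u (fun S => c * g S) = c * expval u g.
Proof. by move=> uv; rewrite /expval RintegralZl //; exact: alloc_integrable. Qed.

Lemma expvalD u g g' : is_valuation u ->
  expval u (fun S => g S + g' S) = expval u g + expval u g'.
Proof. by move=> uv; rewrite /expval RintegralD //; exact: alloc_integrable. Qed.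

Lemma expval_cst u (c : R) : expval u (fun=> c) = c.
Proof.
rewrite /expval Rintegral_cst //; transitivity (c * fine (1%E : \bar R)).
  by congr (_ * fine _); exact: probability_setT.
by rewrite /= mulr1.
Qed.

Lemma le_expval u g g' : is_valuation u ->
  (forall S : {set 'I_m}, (#|S| <= k)%N -> g S <= g' S) -> expval u g <= expval u g'.
Proof.
move=> uv gg'; have [card _ _] := M_wd (solo_valid uv).
by apply: le_Rintegral => //; [exact: alloc_integrable..|move=> w _; exact/gg'/card].
Qed.

Lemma expectation_alloc u g : is_valuation u ->
  ('E_(seed_law M)[fun w => g (alloc (solo u) w)] = (expval u g)%:E)%E.
Proof.
move=> uv; rewrite unlock /expval /Rintegral fineK //.
by apply: integrable_fin_num => //; exact: alloc_integrable.
Qed.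

Lemma expectation_welfare u : is_valuation u ->
  ('E_(seed_law M)[fun w => welfare (solo u) (alloc (solo u) w)] = (expval u u)%:E)%E.
Proof.
move=> uv; rewrite -(expectation_alloc u uv); congr expectation.
by apply/funext => w; rewrite welfare_solo.
Qed.

Lemma exp_utility_solo u u' : is_valuation u' ->
  exp_utility M i0 u (solo u') = (expval u' u - exppay u')%:E.
Proof.
move=> uv; have [_ _ /(_ i0) ip] := M_wd (solo_valid uv).
rewrite /exp_utility unlock /expval /exppay.
rewrite -RintegralB //; last exact: alloc_integrable.
rewrite /Rintegral fineK //; apply: integrable_fin_num => //.
rewrite (_ : (fun _ => _) = ((EFin \o (fun w => u (alloc (solo u') w)))
   \- (EFin \o payment (solo u') i0))%E) //.
by apply: integrableB => //; exact: alloc_integrable.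
Qed.

Lemma exppay_ge0 u : is_valuation u -> 0 <= exppay u.
Proof.
move=> uv; have [_ _ /(_ i0) ip] := M_wd (solo_valid uv).
have := M_np i0 (solo_valid uv).
by rewrite unlock /exppay /Rintegral -lee_fin fineK //; exact: integrable_fin_num.
Qed.

Lemma exppay_le u : is_valuation u -> exppay u <= expval u u.
Proof.
move=> uv; have := M_ir i0 (solo_valid uv).
by rewrite {1}/solo /= eqxx exp_utility_solo // lee_fin subr_ge0.
Qed.

Lemma solo_truthful u u' : is_valuation u -> is_valuation u' ->
  (1 - eps) * (expval u' u - exppay u') <= expval u u - exppay u.
Proof.
move=> uv uv'; have := M_at i0 (solo_valid uv) uv'.
rewrite solo_update /= [in X in exp_utility M i0 X]/solo /= eqxx.
by rewrite !exp_utility_solo // -EFinM lee_fin.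
Qed.

(* Reporting the much smaller [d * t * psi] makes the payments, which individual
   rationality bounds by the reported value, negligible for the type [t * w]. *)
Lemma small_report (w psi : {set 'I_m} -> R) (t d del sig : R) : is_valuation w -> is_valuation psi ->
  0 < t -> 0 <= d -> eps <= 1 ->
  (forall S : {set 'I_m}, (#|S| <= k)%N -> (1 + del) * psi S <= w S + sig) ->
  (1 - eps) * ((1 + del - d) * expval (fun S => d * t * psi S) psi - sig)
    <= expval (fun S => t * w S) w.
Proof.
move=> wv pv t0 d0 e1 H.
have twv := valuation_scale (ltW t0) wv.
have dt0 : 0 <= d * t by rewrite mulr_ge0 // ltW.
have uv := valuation_scale dt0 pv.
have := solo_truthful twv uv.
have := exppay_ge0 twv.
have := exppay_le uv.
rewrite !expvalZ //.
set V := expval _ psi; set p := exppay _; set p' := exppay _.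
have W : (1 + del) * V <= expval (fun S => d * t * psi S) w + sig.
  rewrite -(expval_cst (fun S => d * t * psi S) sig) -expvalD // -expvalZ //.
  exact: le_expval.
set W1 := expval _ w in W *; set W2 := expval _ w.
(* In [tr] the truthful payment [p'] is dropped since it is nonnegative, and the payment [p] after
   the misreport is at most [d * t * V]. *)
move=> pV p'0 tr; rewrite -(ler_pM2l t0).
have e0 : 0 <= 1 - eps by lra.
have : (1 - eps) * (t * ((1 + del - d) * V - sig)) <= (1 - eps) * (t * W1 - p).
  rewrite ler_wpM2l //.
  have := ler_wpM2l (ltW t0) W; nra.
nra.
Qed.

End SinglePlayer.

(** * Hiding a half of a set of projects *)

Section Hiding.
Variables (R : realType) (n m : nat) (M : mechanism R n m) (i0 : 'I_n).
Variables (h lo hi q p : nat).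
Hypothesis q_gt0 : (0 < q)%N.
Hypothesis mE : m = (4 * q ^ 2)%N.
Hypothesis hE : h = (q * p)%N.
Hypothesis p_ge3 : (2 < p)%N.
Hypothesis lo_hi : (lo <= hi)%N.
Hypothesis h_lo : (4 * h <= 4 ^ lo)%N.
Let k := (4 ^ hi)%N.
Hypothesis M_wd : well_defined k M.
Variable b : R.
Hypothesis M_qb : query_bound b M.

Definition hidden (A C S : {set 'I_m}) : R :=
  multicov R h lo hi.+1 #|S :&: A| #|S :&: C|.

Definition visible (B S : {set 'I_m}) : R := multicov R h lo hi.+1 0 #|S :&: B|.

Lemma hidden_valuation A C : is_valuation (hidden A C).
Proof. exact: (sub2_valuation (multicov_submodular2 _ _ _ _)). Qed.

Lemma visible_valuation B : is_valuation (visible B).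
Proof.
have := hidden_valuation finset.set0 B; congr is_valuation.
by apply/funext => S; rewrite /hidden finset.setI0 cards0.
Qed.

Lemma hidden_le A C S : hidden A C S <= 2 ^+ hi.+1.
Proof. exact: multicov_le. Qed.

Lemma visible_le B S : visible B S <= 2 ^+ hi.+1.
Proof. exact: multicov_le. Qed.

Lemma hidden_visible (B J S : {set 'I_m}) :
  ~~ imbalanced (2 * q * p) (S :&: B) J ->
  hidden (B :&: J) (B :\: J) S = visible B S.
Proof.
rewrite /imbalanced -leqNgt => bal.
rewrite /hidden finset.setIA finset.setIDA multicov_balanced ?cardsID //.
by rewrite hE mulnA.
Qed.

Lemma hidden_gain A C (S : {set 'I_m}) : (#|S| <= k)%N ->
  (1 + 1 / 768) * visible A S <= hidden A C S + 2 ^+ lo / 384.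
Proof.
move=> Sk; have SA : (#|S :&: A| <= 4 ^ hi)%N.
  by apply: leq_trans Sk; apply/subset_leq_card/finset.subsetIl.
apply: le_trans (multicov_gain R h_lo SA lo_hi) _.
have := sub2_mono (multicov_submodular2 R h lo hi.+1) 0 #|S :&: C| #|S :&: A| 0.
by rewrite addn0 add0n lerD2r.
Qed.

(** The complement reverses the one-sided test: [B :\: J] may exceed [B :&: J] by at most
    [2 * q * p], so [B :&: J] is never too small. *)
Definition large_splits (B : {set 'I_m}) : {set {set 'I_m}} :=
  [set J | ~~ imbalanced (2 * q * p) B (~: J)].

Lemma large_split_card (B J : {set 'I_m}) : (4 * q * p <= #|B|)%N ->
  J \in large_splits B -> (#|B| <= 4 * #|B :&: J|)%N.
Proof.
rewrite inE /imbalanced -leqNgt finset.setDE finset.setCK -finset.setDE.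
by have := cardsID J B; lia.
Qed.

(** Complementation is a bijection, so the bad splits are as many as the imbalanced ones: a fraction
    of at most [4 / 2^p <= 1/2], as [p >= 3]. *)
Lemma card_large_splits (B : {set 'I_m}) : 2 ^+ m <= 2 * #|large_splits B|%:R :> R.
Proof.
have -> : large_splits B = ~: [set J | imbalanced (2 * q * p) B (~: J)].
  by apply/setP => J; rewrite !inE.
have := cardsC [set J | imbalanced (2 * q * p) B (~: J)].
rewrite -cardsT -powersetT card_powerset cardsT card_ord => /(congr1 (fun x => x%:R : R)).
rewrite natrD natrX.
have -> : #|[set J | imbalanced (2 * q * p) B (~: J)]|
        = #|[set J | imbalanced (2 * q * p) B J]|.
  rewrite -[RHS](card_imset _ (inv_inj (@finset.setCK _))).
  congr #|pred_of_set _|; apply/setP => J; rewrite inE.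
  apply/idP/imsetP => [im|[J' + ->]]; last by rewrite inE finset.setCK.
  by exists (~: J); rewrite ?inE ?finset.setCK.
have := @card_imbalanced R m q p B q_gt0 mE.
have : 4 / 2 ^+ p * 2 ^+ m <= 1 / 2 * 2 ^+ m :> R.
  rewrite ler_wpM2r ?exprn_ge0 // ler_pdivrMr ?exprn_gt0 //.
  have : 2 ^+ 3 <= 2 ^+ p :> R by rewrite ler_weXn2l //; lra.
  by rewrite !exprS expr0; lra.
lra.
Qed.

(* Averaging over all splits is done seed by seed, so no measurability of the
   transcripts is needed. *)
Lemma hiding_pointwise (B : {set 'I_m}) (t : R) (w : seed M) : 0 < t ->
  \sum_(J in large_splits B) hidden (B :&: J) (B :\: J)
    (alloc (solo i0 (fun S => t * hidden (B :&: J) (B :\: J) S)) w)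
  <= #|large_splits B|%:R * visible B (alloc (solo i0 (fun S => t * visible B S)) w)
     + 2 ^+ hi.+1 * ((b + 1) * (4 / 2 ^+ p * 2 ^+ m)).
Proof.
move=> t0; set psi := fun S => t * visible B S.
pose wJ (J : {set 'I_m}) S := t * hidden (B :&: J) (B :\: J) S.
have psiv : is_valuation psi by apply: valuation_scale (ltW t0) (visible_valuation B).
set S0 := alloc (solo i0 psi) w.
(* [Q] does not depend on [J], so a union bound works despite adaptivity; the outcome [S0] is
   included because its value must agree too. *)
pose Q := S0 :: queries (strategy w) (solo i0 psi).
have pt J : hidden (B :&: J) (B :\: J) (alloc (solo i0 (wJ J)) w)
    <= visible B S0 + 2 ^+ hi.+1 * \sum_(S <- Q) (imbalanced (2 * q * p) (S :&: B) J)%:R.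
  (* An imbalanced set in [Q] costs at most the maximal value [2^(hi + 1)]; without one, both runs
     receive the same answers and end in [S0]. *)
  have [/hasP [S SQ im]|/hasPn bal] := boolP (has (fun S => imbalanced (2 * q * p) (S :&: B) J) Q).
    apply: le_trans (hidden_le _ _ _) _.
    have [v0 _ _ _] := visible_valuation B.
    have : 1 <= \sum_(S <- Q) (imbalanced (2 * q * p) (S :&: B) J)%:R :> R.
      rewrite (big_rem S SQ) /= im lerDl; apply: sumr_ge0 => *; exact: ler0n.
    have : 0 <= 2 ^+ hi.+1 :> R by apply: exprn_ge0.
    by have := v0 S0; nra.
  have -> : alloc (solo i0 (wJ J)) w = S0.
    rewrite /S0 /alloc (@run_agree _ _ _ _ (solo i0 psi)) // => A AQ i.
    rewrite /solo /=; case: eqP => // _.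
    by rewrite /wJ /psi hidden_visible // bal // inE AQ orbT.
  rewrite hidden_visible; last by rewrite bal // mem_head.
  rewrite lerDl mulr_ge0 ?exprn_ge0 //; apply: sumr_ge0 => *; exact: ler0n.
apply: (@le_trans _ _ (\sum_(J in large_splits B) (visible B S0
   + 2 ^+ hi.+1 * \sum_(S <- Q) (imbalanced (2 * q * p) (S :&: B) J)%:R))).
  by apply: ler_sum => J _; exact: pt.
rewrite big_split /= sumr_const -[visible B S0 *+ _]mulr_natl lerD2l -mulr_sumr ler_wpM2l ?exprn_ge0 //.
rewrite exchange_big /=.
apply: (@le_trans _ _ (\sum_(S <- Q) (4 / 2 ^+ p * 2 ^+ m))).
  apply: ler_sum => S _; apply: le_trans (card_imbalanced R p (S :&: B) q_gt0 mE).
  rewrite -sum1_card natr_sum [leLHS]big_mkcond [leRHS]big_mkcond /=.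
  apply: ler_sum => J _; rewrite [X in if X then 1 else _]inE.
  by case: (J \in _); case: (imbalanced _ _ J) => /=; rewrite ?lexx ?ler01.
have -> : \sum_(S <- Q) (4 / 2 ^+ p * 2 ^+ m) = (size Q)%:R * (4 / 2 ^+ p * 2 ^+ m) :> R.
  by rewrite big_const_seq count_predT iter_addr_0 -[LHS]mulr_natl.
have T0 : 0 <= 4 / 2 ^+ p * 2 ^+ m :> R by rewrite mulr_ge0 ?divr_ge0 ?exprn_ge0.
rewrite ler_wpM2r //.
rewrite /= size_queries -natr1 lerD2r.
exact/M_qb/solo_valid.
Qed.

(** A space of total mass [1] has a seed, and any seed yields a natural number of queries below
    [b]. *)
Lemma query_bound_ge0 : 0 <= b.
Proof.
have [w _] : exists w : seed M, True.
  have [//|noseed] := pselect (exists w : seed M, True).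
  have := probability_setT (seed_law M).
  rewrite (_ : [set: seed M]%classic = set0) ?measure0.
    by move=> /eqP; rewrite eq_sym onee_eq0.
  by apply/seteqP; split=> // w _; apply: noseed; exists w.
by apply: le_trans (M_qb w (solo_valid i0 (visible_valuation finset.set0))); rewrite ler0n.
Qed.

(** Some large split does no worse than their average. At least half of all [2^m] sets are large
    splits, which turns the [4] of the summed error into [8]. *)
Lemma hiding (B : {set 'I_m}) (t : R) : 0 < t ->
  exists2 J, J \in large_splits B &
    expval M i0 (fun S => t * hidden (B :&: J) (B :\: J) S) (hidden (B :&: J) (B :\: J))
    <= expval M i0 (fun S => t * visible B S) (visible B)
       + 2 ^+ hi.+1 * ((b + 1) * (8 / 2 ^+ p)).
Proof.
move=> t0; have psiv := valuation_scale (ltW t0) (visible_valuation B).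
have wv J := valuation_scale (ltW t0) (hidden_valuation (B :&: J) (B :\: J)).
set V := expval _ _ _ (visible B).
pose W J := expval M i0 (fun S => t * hidden (B :&: J) (B :\: J) S) (hidden (B :&: J) (B :\: J)).
set N := #|large_splits B|.
have half := card_large_splits B.
have N0 : 0 < N%:R :> R.
  by have : 0 < 2 ^+ m :> R by [apply: exprn_gt0]; rewrite -/N in half *; lra.
pose e := 2 ^+ hi.+1 * ((b + 1) * (4 / 2 ^+ p * 2 ^+ m)).
have sumW : \sum_(J in large_splits B) W J <= N%:R * V + e.
  have [int <-] := @Rintegral_sum _ _ _ (seed_law M) {set 'I_m} (index_enum _)
    (mem (large_splits B))
    (fun J w => hidden (B :&: J) (B :\: J) (alloc (solo i0 (fun S => t * hidden (B :&: J) (B :\: J) S)) w))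
    (fun J => alloc_integrable i0 M_wd _ (wv J)).
  have -> : N%:R * V + e
      = expval M i0 (fun S => t * visible B S) (fun S => N%:R * visible B S + e).
    by rewrite (expvalD i0 M_wd) // (expvalZ i0 M_wd) // expval_cst.
  apply: le_Rintegral; [exact: measurableT|exact: int| |].
    exact: (alloc_integrable i0 M_wd (fun S => N%:R * visible B S + e) psiv).
  by move=> w _; exact: hiding_pointwise.
apply: contrapT => no.
have : \sum_(J in large_splits B) (V + 2 ^+ hi.+1 * ((b + 1) * (8 / 2 ^+ p)))
     < \sum_(J in large_splits B) W J.
  have /card_gt0P [J0 J0l] : (0 < N)%N by rewrite -(@ltr_nat R).
  apply: ltr_sum => [|J Jl]; first by apply/hasP; exists J0; rewrite ?mem_index_enum.
  by rewrite ltNge; apply/negP => le; exact: no (ex_intro2 _ _ J Jl le).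
rewrite sumr_const -/N -[_ *+ N]mulr_natl => lt; have := lt_le_trans lt sumW.
rewrite mulrDr ltrD2l /e => {}lt.
have p0 : 0 < 2 ^+ p :> R by apply: exprn_gt0.
have b0 := query_bound_ge0.
have : 2 ^+ hi.+1 * ((b + 1) * (4 / 2 ^+ p * 2 ^+ m))
    <= N%:R * (2 ^+ hi.+1 * ((b + 1) * (8 / 2 ^+ p))).
  have c0 : 0 <= 2 ^+ hi.+1 * ((b + 1) * (4 / 2 ^+ p)) :> R.
    by rewrite mulr_ge0 ?exprn_ge0 // mulr_ge0 ?divr_ge0 //; lra.
  have := ler_wpM2l c0 half; lra.
by rewrite leNgt lt.
Qed.

(** * Descent by repeated halving *)

Hypothesis M_ir : individually_rational M.
Hypothesis M_np : nonneg_payments M.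
Hypothesis M_at : approx_truthful (1 / 6144) M.

Definition attained (A : {set 'I_m}) (t : R) : R :=
  expval M i0 (fun S => t * visible A S) (visible A).

Lemma attained_ge0 A t : 0 < t -> 0 <= attained A t.
Proof.
move=> t0; have Av := valuation_scale (ltW t0) (visible_valuation A).
rewrite -(expval_cst M i0 (fun S => t * visible A S) 0).
apply: (le_expval i0 M_wd) => // S _.
by have [v0 _ _ _] := visible_valuation A.
Qed.

Lemma attained_le A t : 0 < t -> attained A t <= 2 ^+ hi.+1.
Proof.
move=> t0; have Av := valuation_scale (ltW t0) (visible_valuation A).
rewrite -(expval_cst M i0 (fun S => t * visible A S) (2 ^+ hi.+1)).
by apply: (le_expval i0 M_wd) => // S _; exact: visible_le.
Qed.

Definition loss : R := 2 ^+ lo / 384 + 2 ^+ hi.+1 * ((b + 1) * (8 / 2 ^+ p)).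

Lemma loss_ge0 : 0 <= loss.
Proof.
have b0 := query_bound_ge0.
by rewrite addr_ge0 ?divr_ge0 ?mulr_ge0 ?exprn_ge0 ?divr_ge0 ?exprn_ge0 //; lra.
Qed.

(** Shrinking the report by [d = 1/1536] costs half of the gain [1/768]; the factor [1 - 1/6144]
    leaves [(1 - 1/6144) (1 + 1/1536) >= 1 + 1/3072]. *)
Lemma descent_step (B : {set 'I_m}) (t : R) : 0 < t -> (4 * q * p <= #|B|)%N ->
  exists2 A : {set 'I_m}, (#|B| <= 4 * #|A|)%N &
    (1 + 1 / 3072) * attained A (1 / 1536 * t) <= attained B t + loss.
Proof.
move=> t0 Bbig; have [J Jl HJ] := hiding B t0.
exists (B :&: J); first exact: large_split_card.
have t'0 : 0 < 1 / 1536 * t by lra.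
have V0 := attained_ge0 (B :&: J) t'0.
have d0 : 0 <= 1 / 1536 :> R by lra.
have e1 : 1 / 6144 <= 1 :> R by lra.
have wv := hidden_valuation (B :&: J) (B :\: J).
have := small_report i0 M_wd M_ir M_np M_at wv (visible_valuation (B :&: J)) t0 d0 e1
  (@hidden_gain (B :&: J) (B :\: J)).
have : 0 <= 2 ^+ lo :> R by apply: exprn_ge0.
move: HJ V0; rewrite /loss -/(attained B t) -/(attained (B :&: J) (1 / 1536 * t)).
lra.
Qed.

(** The accumulated error [3072 * loss] is the fixed point of [e -> (e + loss) / (1 + 1/3072)], so
    it does not grow with [L]. *)
Lemma descent L (B : {set 'I_m}) (t : R) : 0 < t -> (4 * q * p * 4 ^ L <= #|B|)%N ->
  exists A : {set 'I_m}, exists2 s : R, 0 < s &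
    (#|B| <= 4 ^ L * #|A|)%N /\
    attained A s <= attained B t / (1 + 1 / 3072) ^+ L + 3072 * loss.
Proof.
move=> t0; elim: L => [|L IH] Bbig.
  exists B; exists t => //; split; first by rewrite mul1n.
  by have := loss_ge0; rewrite expr0 divr1; lra.
have [|A [s s0 [BA VA]]] := IH; first by move: Bbig; rewrite expnS; lia.
have Abig : (4 * q * p <= #|A|)%N.
  have e0 : (0 < 4 ^ L)%N by rewrite expn_gt0.
  rewrite -(leq_pmul2l e0); apply: leq_trans BA; apply: leq_trans Bbig.
  by rewrite expnS mulnC leq_mul2l leq_pmull ?orbT.
have [A' AA' VA'] := descent_step s0 Abig.
exists A'; exists (1 / 1536 * s); first by lra.
split.
  by apply: leq_trans BA _; rewrite expnSr -mulnA leq_mul2l AA' orbT.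
have r0 : 0 < 1 + 1 / 3072 :> R by lra.
have E : (1 + 1 / 3072) * (attained B t / (1 + 1 / 3072) ^+ L.+1)
    = attained B t / (1 + 1 / 3072) ^+ L.
  set rho := 1 + _ in r0 *.
  by rewrite exprS; field; rewrite expf_neq0 ?gt_eqF.
rewrite -(ler_pM2l r0) [leRHS]mulrDr E; apply: le_trans VA' _.
by have := loss_ge0; move: VA; lra.
Qed.

(** Any [k] projects of [A] are worth [3/4 * 2^hi] under [visible A]. The scale [s] cancels, so it
    does not matter how small the descent has made it. *)
Lemma approx_attained (c : R) (A : {set 'I_m}) (s : R) : 0 <= c -> approximates k c M -> (k <= #|A|)%N ->
  0 < s -> c * (3 / 4 * 2 ^+ hi) <= attained A s.
Proof.
move=> c0 apx /card_geqP [l [ul sl lA]] s0.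
pose S : {set 'I_m} := [set x in l].
have Sk : #|S| = k by rewrite cardsE; move/card_uniqP: ul => ->.
have Av := valuation_scale (ltW s0) (visible_valuation A).
have := apx _ (solo_valid i0 Av).
rewrite (expectation_welfare i0 M_wd Av) lee_fin (expvalZ i0 M_wd) // => H.
rewrite -(ler_pM2l s0); apply: le_trans H.
rewrite mulrCA ler_wpM2l //.
have SA : S :&: A = S.
  by apply/finset.setIidPl/fintype.subsetP => x; rewrite inE; exact: lA.
have : s * visible A S <= opt_welfare k (solo i0 (fun S => s * visible A S)).
  rewrite -(welfare_solo i0 (fun S => s * visible A S)).
  by apply: (le_bigmax_cond 0 (fun S => welfare (solo i0 (fun S => s * visible A S)) S)); rewrite Sk.
apply: le_trans; rewrite ler_pM2l // /visible SA Sk.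
exact: multicov_lower.
Qed.

Lemma approx_ratio_bound (c : R) L : 0 <= c -> approximates k c M ->
  (4 * q * p * 4 ^ L <= m)%N -> (4 ^ L * k <= m)%N ->
  c * (3 / 4 * 2 ^+ hi) <= 2 ^+ hi.+1 / (1 + 1 / 3072) ^+ L + 3072 * loss.
Proof.
move=> c0 apx big1' big2'.
have cT : #|[set: 'I_m]| = m by rewrite cardsT card_ord.
have [|A [s s0 [mA VA]]] := @descent L [set: 'I_m] 1 ltr01; first by rewrite cT.
have kA : (k <= #|A|)%N.
  have e0 : (0 < 4 ^ L)%N by rewrite expn_gt0.
  by rewrite -(leq_pmul2l e0); move: mA; rewrite cT; apply: leq_trans.
apply: le_trans (approx_attained c0 apx kA s0) _.
have r0 : 0 <= ((1 + 1 / 3072) ^+ L)^-1 :> R.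
  by rewrite invr_ge0; apply: exprn_ge0; lra.
apply: le_trans VA _; rewrite lerD2r; apply: (ler_wpM2r r0); exact: (attained_le _ ltr01).
Qed.

End Hiding.

(** * Choice of the parameters *)

Lemma poly_le_monomial (R : realType) (Q : {poly R}) :
  exists a d : nat, forall x : R, 1 <= x -> Q.[x] <= 2 ^+ a * x ^+ d.
Proof.
pose C := \sum_(i < size Q) `|Q`_i|.
have C0 : 0 <= C by apply: sumr_ge0.
exists (Num.bound C), (size Q) => x x1.
have Ca : C <= 2 ^+ Num.bound C.
  apply: le_trans (ltW (archi_boundP C0)) _.
  by rewrite -natrX ler_nat ltnW // ltn_expl.
have x0 : 0 <= x by apply: le_trans x1.
apply: (@le_trans _ _ (C * x ^+ size Q)); last by rewrite ler_wpM2r // exprn_ge0.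
rewrite horner_coef mulr_suml; apply: ler_sum => i _.
apply: le_trans (ler_norm _) _; rewrite normrM ler_wpM2l //.
by rewrite ger0_norm ?exprn_ge0 // ler_weXn2l // ltnW.
Qed.

(** For [m = 2^(20r)] and [p = 4^r], the left side is at most [2] to a power linear in [r], and
    [r^2 <= 4^r] outgrows it. *)
Lemma poly_exp2_negligible (R : realType) (Q : {poly R}) : exists N : nat,
  forall r, (N <= r)%N -> (Q.[(2 ^ (20 * r))%:R] + 1) * (2 ^+ 16 * 4 ^+ r) <= 2 ^+ (4 ^ r).
Proof.
have [a [d Qad]] := poly_le_monomial Q.
exists (a + 20 * d + 19)%N => r Nr.
have X1 : 1 <= (2 ^ (20 * r))%:R :> R by rewrite ler1n expn_gt0.
have := Qad _ X1; rewrite natrX -exprM -exprD.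
have Y1 : 1 <= 2 ^+ (a + 20 * r * d) :> R by rewrite exprn_ege1 // ler1n.
move=> H.
have : 2 ^+ (a + 20 * r * d + 1 + 16 + 2 * r) <= 2 ^+ (4 ^ r) :> R.
  rewrite ler_weXn2l ?ler1n //.
  have r2 : (r * r <= 4 ^ r)%N.
    by rewrite (expnMn 2 2 r : 4 ^ r = _)%N leq_mul // ltnW // ltn_expl.
  by apply: leq_trans r2; nia.
apply: le_trans.
rewrite (_ : 4 ^+ r = 2 ^+ (2 * r)); last by rewrite exprM expr2; congr (_ ^+ _); lra.
rewrite -exprD -(addnA (_ + 1)%N) [leRHS]exprD ler_wpM2r ?exprn_ge0 //.
by rewrite exprD expr1; lra.
Qed.

Lemma exp_gain_ge2 (R : realType) : exists2 N : nat, (0 < N)%N & 2 <= (1 + 1 / 3072) ^+ N :> R.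
Proof.
have c0 : 0 < 1 / 3072 :> R by lra.
pose N := Num.bound (3072 : R).
have N0 : 3072 < N%:R :> R by apply: archi_boundP; rewrite ler0n.
exists N; first by rewrite -(@ltr_nat R); lra.
have := @bernoulli_expr R (1 / 3072) N.
have h1 : -1 <= 1 / 3072 :> R by lra.
move=> /(_ h1); apply: le_trans; lra.
Qed.

Lemma powR_exp2_neg (R : realType) (N u : nat) : (0 < N)%N ->
  (2 ^ (20 * (N * u)))%:R `^ (- (20 * N)%:R^-1) = (2 ^+ u)^-1 :> R.
Proof.
move=> N0; have e : (20 * (N * u) = u * (20 * N))%N by lia.
rewrite e expnM !natrX -powR_mulrn ?exprn_ge0 //.
rewrite -powRrM mulrN divff ?pnatr_eq0; last by lia.
by rewrite powRN powRr1 ?exprn_ge0.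
Qed.

(** The parameters are [m = 2^(20r)], [k = 4^(8r)], [q = 2^(10r-1)], [p = 4^r], [lo = 6r+1],
    [hi = 8r] and [L = 2r], so that [4^L = m/k]. *)
Lemma exponent_identities r : (0 < r)%N ->
  [/\ (4 ^ (8 * r) <= 2 ^ (20 * r))%N,
      (2 ^ (20 * r) = 4 * (2 ^ (10 * r - 1)) ^ 2)%N,
      (4 * (2 ^ (10 * r - 1) * 4 ^ r) <= 4 ^ (6 * r + 1))%N,
      (4 * 2 ^ (10 * r - 1) * 4 ^ r * 4 ^ (2 * r) <= 2 ^ (20 * r))%N
    & (4 ^ (2 * r) * 4 ^ (8 * r) <= 2 ^ (20 * r))%N].
Proof.
move=> r0; have p4 j : (4 ^ j = 2 ^ (2 * j))%N by rewrite expnM.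
have p44 x : (4 * x = 2 ^ 2 * x)%N by [].
split.
- by rewrite p4 leq_exp2l //; lia.
- by rewrite -expnM p44 -expnD; congr (expn 2 _); lia.
- by rewrite p44 !p4 -!expnD leq_exp2l //; lia.
- by rewrite p44 !p4 -!expnD leq_exp2l //; lia.
- by rewrite !p4 -!expnD leq_exp2l //; lia.
Qed.

Lemma leq_exp2_20 r : (r <= 2 ^ (20 * r))%N.
Proof.
by apply: leq_trans (ltnW (ltn_expl r (isT : 1 < 2)%N)) _; rewrite leq_exp2l // leq_pmull.
Qed.

Lemma exp2_sqr_le (R : realType) u r : (u <= r)%N -> 2 ^+ u * 2 ^+ u <= 4 ^+ r :> R.
Proof.
move=> ur; have -> : 4 = 2 * 2 :> R by lra.
by rewrite exprMn ler_pM ?exprn_ge0 // ler_weXn2l // ler1n.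
Qed.

Lemma exp2_split (R : realType) r : 2 ^+ (8 * r) = 2 ^+ (6 * r) * 4 ^+ r :> R.
Proof.
have -> : 4 = 2 ^+ 2 :> R by rewrite expr2; lra.
by rewrite -exprM -exprD; congr (_ ^+ _); lia.
Qed.

Lemma exp2_ge32 (R : realType) u : (5 <= u)%N -> 32 <= 2 ^+ u :> R.
Proof.
move=> u5; have -> : 32 = 2 ^+ 5 :> R by rewrite !exprS expr0; lra.
by rewrite ler_weXn2l // ler1n.
Qed.

Lemma exp_gain_iter (R : realType) (rho : R) N u : 0 <= rho -> 2 <= rho ^+ N ->
  2 ^+ u * 2 ^+ u <= rho ^+ (2 * (N * u)).
Proof.
move=> rho0 rhoN; have -> : (2 * (N * u) = N * (u + u))%N by lia.
by rewrite -exprD exprM; apply: lerXn2r; rewrite ?nnegrE // exprn_ge0.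
Qed.

(** Here [W = m^gamma], [T] is the gain of the descent, [Z * Y = 2^hi] and [P = 2^p]. In units of
    [Z * Y / W^2], the right side is at most [2 + 16 + 1 = 19], whereas the left side exceeds
    [3/4 * W >= 24]. *)
Lemma no_ratio (R : realType) (c b W T Y P Z : R) :
  0 < Y -> 0 < P -> 0 < Z -> 32 <= W -> W * W <= T -> W * W <= Y ->
  (b + 1) * (2 ^+ 16 * Y) <= P -> W^-1 < c ->
  c * (3 / 4 * (Z * Y)) <= 2 * (Z * Y) / T
    + 3072 * (Z * 2 / 384 + 2 * (Z * Y) * ((b + 1) * (8 / P))) -> False.
Proof.
move=> Y0 P0 Z0 W32 WT WY bP cW.
have W0 : 0 < W by lra.
have WW0 : 0 < W * W by rewrite mulr_gt0.
have T0 : 0 < T by apply: lt_le_trans WT.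
have ZY0 : 0 < Z * Y by rewrite mulr_gt0.
have X1 : 2 * (Z * Y) / T <= 2 * (Z * Y) / (W * W).
  by rewrite ler_wpM2l ?lef_pV2 //; lra.
have X2 : Z <= Z * Y / (W * W).
  by rewrite ler_pdivlMr // ler_wpM2l // ltW.
have X3 : 6144 * (Y * ((b + 1) * (8 / P))) <= 1.
  have E16 : 2 ^+ 16 = 8 * 2 ^+ 13 :> R.
    by rewrite (_ : 16 = 3 + 13)%N // exprD; congr (_ * _); rewrite !exprS expr0; lra.
  have E13 : 6144 <= 2 ^+ 13 :> R.
    rewrite (_ : 13 = 5 + 5 + 3)%N // !exprD (_ : 2 ^+ 5 = 32 :> R).
      by rewrite (_ : 2 ^+ 3 = 8 :> R); [lra | rewrite !exprS expr0; lra].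
    by rewrite !exprS expr0; lra.
  move: (2 ^+ 13 : R) E16 E13 bP => K -> E13 bP.
  have tK : Y * ((b + 1) * (8 / P)) * K <= 1.
    have -> : Y * ((b + 1) * (8 / P)) * K = (b + 1) * (8 * K * Y) / P by ring.
    by rewrite ler_pdivrMr // mul1r.
  move: (Y * _) tK => t tK.
  (* The sign of [b + 1] is not assumed; a negative [t] satisfies the bound trivially. *)
  have [t0|t0] := leP 0 t; last by lra.
  by apply: le_trans tK; rewrite mulrC; apply: ler_wpM2l.
have X4 := ler_wpM2l (ltW Z0) X3.
have Wc : 1 < c * W by rewrite -ltr_pdivrMr // mul1r.
move=> H.
have : c * (3 / 4 * (Z * Y)) <= 19 * (Z * Y) / (W * W) by lra.
rewrite ler_pdivlMr //.
have -> : c * (3 / 4 * (Z * Y)) * (W * W) = 3 / 4 * (c * W) * W * (Z * Y) by ring.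
rewrite ler_pM2r // => {}H.
have : W <= c * W * W by rewrite ler_peMl ?ltW.
lra.
Qed.

Theorem mainTheorem2 (R : realType) :
  exists eps gamma : R, 0 < eps /\ 0 < gamma /\
  forall n : nat, (0 < n)%N ->
  ~ exists M : forall m : nat, nat -> mechanism R n m,
    [/\ forall m k : nat, (k <= m)%N ->
          [/\ well_defined k (M m k),
              individually_rational (M m k),
              nonneg_payments (M m k)
            & approx_truthful eps (M m k)],
        exists q : {poly R}, forall m k : nat, (k <= m)%N ->
          query_bound q.[m%:R] (M m k)
      & exists (c : nat -> R) (m0 : nat), forall m : nat, (m0 <= m)%N ->
          m%:R `^ (- gamma) < c m /\
          forall k : nat, (k <= m)%N -> approximates k (c m) (M m k)].
Proof.
have [N N0 rhoN] := exp_gain_ge2 R.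
(* With [m = 2^(20 * N * u)] this [gamma] gives [m^(-gamma) = 2^(-u)], while [2 * N * u] halvings
   gain a factor of at least [4^u]. *)
exists (1 / 6144), ((20 * N)%:R^-1); split; first by lra.
split; first by rewrite invr_gt0 ltr0n muln_gt0 N0.
move=> n n0 [M [Mok [Q MQ] [c [m0 Mc]]]].
have [r0 Qr] := poly_exp2_negligible Q.
(* [u >= 5] provides [W = 2^u >= 32] in [no_ratio]; the other bounds make [m] large enough for the
   query polynomial and for the ratio [c]. *)
have [u [r0u m0u u5]] : exists u : nat, [/\ r0 <= u, m0 <= u & 5 <= u]%N.
  by exists (r0 + m0 + 5)%N; split; lia.
have rho0 : 0 <= 1 + 1 / 3072 :> R by lra.
have rhoW := exp_gain_iter u rho0 rhoN.
have cm_le := @powR_exp2_neg R N u N0.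
have [r rE] : exists r, r = (N * u)%N by exists (N * u)%N.
have ur : (u <= r)%N by rewrite rE leq_pmull.
rewrite -rE in rhoW cm_le.
have r_gt0 : (0 < r)%N by lia.
have lohi : (6 * r + 1 <= 8 * r)%N by lia.
have Pbig := Qr r (leq_trans r0u ur).
have m0m := leq_trans m0u (leq_trans ur (leq_exp2_20 r)).
have [km mE qpE b1 b2] := exponent_identities r_gt0.
have [m mdef] : exists m, m = (2 ^ (20 * r))%N by exists (2 ^ (20 * r))%N.
rewrite -mdef in km mE b1 b2 Pbig m0m cm_le.
have [wd ir np at_] := Mok _ _ km.
have [cm /(_ _ km) apx] := Mc _ m0m.
rewrite cm_le in cm.
have c0 : 0 <= c m by rewrite (le_trans _ (ltW cm)) // invr_ge0 exprn_ge0.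
have q0 : (0 < 2 ^ (10 * r - 1))%N by rewrite expn_gt0.
have p3 : (2 < 4 ^ r)%N by apply: (@leq_trans (4 ^ 1)) => //; rewrite leq_exp2l.
have := approx_ratio_bound (Ordinal n0) q0 mE erefl p3 lohi qpE wd (MQ _ _ km)
  ir np at_ c0 apx b1 b2.
have W0 : 0 < 2 ^+ u :> R by rewrite exprn_gt0.
have Y0 : 0 < 4 ^+ r :> R by rewrite exprn_gt0.
have YW := exp2_sqr_le R ur.
have P0 : 0 < 2 ^+ (4 ^ r) :> R by rewrite exprn_gt0.
have Z0 : 0 < 2 ^+ (6 * r) :> R by rewrite exprn_gt0.
have W32 := exp2_ge32 R u5.
rewrite /loss (exprS 2 (8 * r)) (exprD 2 (6 * r) 1) expr1 exp2_split.
exact: (no_ratio Y0 P0 Z0 W32 rhoW YW Pbig cm).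
Qed.
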